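(* Let $\mathsf A$ be the Cartan matrix of type $B_n$, with nodes labelled so that $\alpha_1$ is the short simple root. The map $\lambda\mapsto\mathrm{wt}(\lambda):=\Lambda_1-\sum_{b\in\lambda}\alpha_{\mathsf{res}(b)}$ gives a one-to-one correspondence between the set $\mathfrak P_n$ of strict partitions $\lambda=(\lambda_1,\lambda_2,\dots)$ with $\lambda_1\le n$ and the Weyl group orbit $\mathbb B(\Lambda_1)=\mathsf W\cdot\Lambda_1$.
   Context: Type $B_n$ has index set $I=\{1,\dots,n\}$ and Dynkin diagram the chain $1-2-\cdots-n$ with double bond between $1$ and $2$, $\alpha_1$ short: $\langle h_1,\alpha_2\rangle=-2$, $\langle h_2,\alpha_1\rangle=-1$, all other adjacent entries $-1$. $\Lambda_1$ is the fundamental weight with $\langle h_j,\Lambda_1\rangle=\delta_{j,1}$; the Weyl group $\mathsf W$ is generated by $s_j(\lambda)=\lambda-\langle h_j,\lambda\rangle\alpha_j$. A strict partition $\lambda=(\lambda_1>\cdots>\lambda_\ell>0)$ (the empty partition is allowed) is identified with its shifted Young diagram, consisting of boxes $(i,j)$, $1\le i\le\ell$, $i\le j\le\lambda_i+i-1$ (row $i$, column $j$); the residue of a box is $\mathsf{res}(i,j)=j-i+1$. *)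

(* Defs.v *)
From HB Require Import structures.
From mathcomp Require Import all_boot all_order all_algebra.
From mathcomp Require Import boolp classical_sets functions.

Set Implicit Arguments.
Unset Strict Implicit.
Unset Printing Implicit Defensive.

Import GRing.Theory.

Local Open Scope classical_set_scope.
Local Open Scope ring_scope.

(* The entry <h_i, alpha_j> of the Cartan matrix of type B_n. The nodes are
   labelled 1, ..., n, so both arguments are meant to range over [1, n]. *)
Definition cartanB (i j : nat) : int :=
  if i == j then 2
  else if (i == 1%N) && (j == 2%N) then -2
  else if (i.+1 == j) || (j.+1 == i) then -1
  else 0.

(* The weight lattice in the basis of fundamental weights: the coordinate of
   index k : 'I_n is the pairing with the coroot of node k.+1. *)
Definition weight (n : nat) := 'rV[int]_n.

Definition coroot_pairing n (k : 'I_n) (x : weight n) : int := x ord0 k.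

(* In [fundamental_weight] and [simple_root], j is a node label in [1, n]. *)
Definition fundamental_weight n (j : nat) : weight n :=
  \row_(k < n) (k.+1 == j)%:R.

Definition simple_root n (j : nat) : weight n :=
  \row_(k < n) cartanB k.+1 j.

(* The simple reflection s_j for the node j = k.+1. *)
Definition simple_reflection n (k : 'I_n) (x : weight n) : weight n :=
  x - coroot_pairing k x *: simple_root n k.+1.

(* The group of self-bijections of the weight lattice generated by the simple
   reflections. *)
Inductive weyl_group n : set (weight n -> weight n) :=
| weyl_id : weyl_group id
| weyl_reflection (k : 'I_n) : weyl_group (simple_reflection k)
| weyl_comp f g : weyl_group f -> weyl_group g -> weyl_group (f \o g)
| weyl_inv f g :
    weyl_group f -> cancel f g -> cancel g f -> weyl_group g.

Definition weyl_orbit n (x : weight n) : set (weight n) :=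
  [set y | exists2 w, weyl_group w & y = w x].

(* A strict partition is the decreasing sequence of its positive parts. *)
Definition strict_partition (la : seq nat) : bool :=
  sorted gtn la && all (fun p => 0 < p)%N la.

(* The part lambda_i, with i counted from 1; it is 0 for i > l(lambda). *)
Definition part (la : seq nat) (i : nat) : nat := nth 0%N la i.-1.

Definition strict_partitions (n : nat) : set (seq nat) :=
  [set la | strict_partition la /\ (part la 1 <= n)%N].

Definition shifted_diagram (la : seq nat) : seq (nat * nat) :=
  [seq (i, j) | i <- iota 1 (size la), j <- iota i (part la i)].

Lemma mem_shifted_diagram la i j : strict_partition la ->
  ((i, j) \in shifted_diagram la) =
  (1 <= i <= size la)%N && (i <= j <= part la i + i - 1)%N.
Proof.
move=> /andP[_ /allP la_gt0]; apply/allpairsPdep/andP => /=.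
  move=> [i' [j' [+ + [-> ->]]]].
  rewrite !mem_iota add1n ltnS => Hi /andP[le_ij lt_j].
  by rewrite Hi le_ij addnC subn1; split=> //; case: (i' + _)%N lt_j.
move=> [Hi /andP[le_ij le_j]]; exists i, j; split=> //.
  by rewrite mem_iota add1n ltnS.
have part_gt0 : (0 < part la i)%N.
  apply/la_gt0/mem_nth; case/andP: Hi; by case: (i).
rewrite mem_iota le_ij addnC /= (leq_ltn_trans le_j) //.
by rewrite subn1 ltn_predL addn_gt0 part_gt0.
Qed.

Lemma shifted_diagram_uniq la : uniq (shifted_diagram la).
Proof.
apply: allpairs_uniq_dep; first exact: iota_uniq.
  by move=> i _; exact: iota_uniq.
by move=> [i j] [i' j'] _ _ /= [-> ->].
Qed.

(* Boxes of a shifted diagram satisfy i <= j, so the truncated subtraction is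
   harmless. *)
Definition residue (b : nat * nat) : nat := (b.2 - b.1 + 1)%N.

Definition wt n (la : seq nat) : weight n :=
  fundamental_weight n 1 - \sum_(b <- shifted_diagram la) simple_root n (residue b).

(* Main.v *)
(* In orthogonal coordinates e_1, ..., e_n with alpha_1 = e_1 and
   alpha_r = e_r - e_(r-1), a row of length p contributes
   alpha_1 + ... + alpha_p = e_p, so wt la = Lambda_1 - \sum_(p in la) e_p
   depends only on the set of parts of la, a subset of {1, ..., n}. On these
   subsets s_1 toggles the element 1 and s_(q+1) exchanges q and q+1; hence the
   weights wt la are stable under the Weyl group, and every subset is reached
   from the empty one by inserting 1 and pushing it upwards, the largest part
   first. The coordinates of wt la determine the subset one element at a time. *)
Require Import Defs.
From mathcomp Require Import all_boot all_order all_algebra.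
From mathcomp Require Import boolp classical_sets functions.
From mathcomp Require Import zify ring.

Set Implicit Arguments.
Unset Strict Implicit.
Unset Printing Implicit Defensive.

Import GRing.Theory Num.Theory.

Local Open Scope classical_set_scope.
Local Open Scope ring_scope.

(** In the orthogonal coordinates this is the vector e_p. *)
Definition row_root n (p : nat) : weight n :=
  \sum_(r <- iota 1 p) simple_root n r.

(** The order of [s] is immaterial here, so parts can be inserted and removed without sorting
    again. *)
Definition parts_weight n (s : seq nat) : weight n :=
  fundamental_weight n 1 - \sum_(p <- s) row_root n p.

Definition parts_in n (s : seq nat) : bool :=
  uniq s && all (fun p => 0 < p <= n)%N s.

(** The columns of row i start at i, so the residues along it are 1, ..., [part la i], each
    occurring once. *)
Lemma wt_parts_weight n la : wt n la = parts_weight n la.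
Proof.
rewrite /wt /parts_weight /shifted_diagram big_allpairs_dep /=; congr (_ - _).
rewrite [RHS](big_nth 0%N) /index_iota subn0 (iotaDl 1 0) big_map.
apply: eq_bigr => i _; rewrite /row_root /part add1n /=.
rewrite (iotaDl 1 0) -[X in iota X _]addn0 iotaDl !big_map.
by apply: eq_bigr => r _; rewrite /residue /= addKn addn1.
Qed.

Lemma row_rootS n p : row_root n p.+1 = row_root n p + simple_root n p.+1.
Proof. by rewrite /row_root -[p.+1 in LHS]addn1 iotaD big_cat big_seq1. Qed.

(** The coroot of the short root alpha_1 is 2 e_1, whence the factor 2; the contributions 2 of
    alpha_1 and -2 of alpha_2 cancel once p exceeds 1. *)
Lemma row_root0E n p (k : 'I_n) : k = 0%N :> nat ->
  row_root n p ord0 k = ((p == 1)%N%:R : int) *+ 2.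
Proof.
move=> k0; elim: p => [|p IHp]; first by rewrite /row_root big_nil mxE.
rewrite row_rootS mxE IHp mxE k0 /cartanB.
by case: p {IHp} => [|[|p]].
Qed.

(** Index [k] stands for node [k.+1], whose coroot is e_(k+1) - e_k. *)
Lemma row_rootE n p (k : 'I_n) : (0 < k)%N ->
  row_root n p ord0 k = (p == k.+1)%:R - (p == k)%:R.
Proof.
move=> k0; elim: p => [|p IHp].
  by rewrite /row_root big_nil mxE; case: (nat_of_ord k) k0.
rewrite row_rootS mxE IHp mxE /cartanB.
do ?case: eqP => //=; lia.
Qed.

Lemma sum_eq_count (s : seq nat) p :
  \sum_(q <- s) ((q == p)%:R : int) = (count_mem p s)%:R.
Proof.
rewrite -sum1_count natr_sum [RHS]big_mkcond.
by apply: eq_bigr => q _ /=; case: (q == p).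
Qed.

Lemma parts_weight0E n s (k : 'I_n) : k = 0%N :> nat ->
  parts_weight n s ord0 k = 1 - (count_mem 1%N s)%:R *+ 2.
Proof.
move=> k0; rewrite !mxE k0 summxE -sum_eq_count -sumrMnl; congr (_ - _).
by apply: eq_bigr => p _; rewrite row_root0E.
Qed.

Lemma parts_weightE n s (k : 'I_n) : (0 < k)%N ->
  parts_weight n s ord0 k = (count_mem (k : nat) s)%:R - (count_mem k.+1 s)%:R.
Proof.
move=> k0; rewrite !mxE summxE eqSS eqn0Ngt k0 sub0r -!sum_eq_count.
rewrite -sumrB -sumrN; apply: eq_bigr => p _.
by rewrite row_rootE // opprB.
Qed.

Lemma parts_weight_cons n p s :
  parts_weight n (p :: s) = parts_weight n s - row_root n p.
Proof. by rewrite /parts_weight big_cons opprD addrCA addrC. Qed.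

Lemma perm_parts_weight n s t : perm_eq s t ->
  parts_weight n s = parts_weight n t.
Proof. by move=> st; rewrite /parts_weight (perm_big _ st). Qed.

Lemma parts_weight_rem n p s : p \in s ->
  parts_weight n (rem p s) = parts_weight n s + row_root n p.
Proof.
by move=> /perm_to_rem/perm_parts_weight ->; rewrite parts_weight_cons subrK.
Qed.

Lemma parts_in_cons n p s : (0 < p <= n)%N -> p \notin s -> parts_in n s ->
  parts_in n (p :: s).
Proof. by rewrite /parts_in /= => -> ->. Qed.

Lemma parts_in_rem n p s : parts_in n s -> parts_in n (rem p s).
Proof.
move=> /andP[us /allP sn]; rewrite /parts_in rem_uniq //=.
by apply/allP => q /mem_rem/sn.
Qed.

Lemma strict_partitions_parts_in n la :
  strict_partitions n la <-> sorted gtn la /\ parts_in n la.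
Proof.
have gtn_trans : transitive gtn by move=> a b c /= ab ca; apply: ltn_trans ca ab.
split=> [[/andP[la_s /allP la_gt0] la1]|[la_s /andP[_ /allP la_in]]].
  split=> //; apply/andP; split.
    by apply: (sorted_uniq gtn_trans) => // p; rewrite /= ltnn.
  apply/allP => p p_la; rewrite la_gt0 //=; apply: leq_trans la1.
  case: la la_s {la_gt0} p_la => // q la /= /(order_path_min gtn_trans)/allP q_la.
  by rewrite inE => /predU1P[->//|/q_la/ltnW].
split; first by rewrite /strict_partition la_s; apply/allP => p /la_in/andP[].
case: la {la_s} la_in => [|p la] //= la_in.
by have /andP[] := la_in p (mem_head _ _).
Qed.

(** Sorting gives each subset a decreasing representative of the same weight. *)
Lemma image_wtE n :
  wt n @` strict_partitions n = parts_weight n @` parts_in n.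
Proof.
apply/seteqP; split=> [_ [la /strict_partitions_parts_in[_ la_in] <-]|].
  by exists la; rewrite ?wt_parts_weight.
move=> _ [s /andP[us sn] <-].
have ss : perm_eq (rev (sort leq s)) s by rewrite perm_rev perm_sort.
exists (rev (sort leq s)).
  apply/strict_partitions_parts_in; split; last first.
    by rewrite /parts_in (perm_uniq ss) us (perm_all _ ss).
  by rewrite rev_sorted; rewrite ltn_sorted_uniq_leq sort_uniq us sort_sorted //; exact: leq_total.
by rewrite wt_parts_weight; apply: perm_parts_weight.
Qed.

Lemma simple_reflectionK n (k : 'I_n) : involutive (@simple_reflection n k).
Proof.
move=> x; apply/rowP => j; rewrite /simple_reflection /coroot_pairing !mxE.
rewrite /cartanB eqxx; ring.
Qed.

Lemma simple_reflection_parts_in n (k : 'I_n) x :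
  (parts_weight n @` parts_in n) x ->
  (parts_weight n @` parts_in n) (simple_reflection k x).
Proof.
move=> [s s_in <-]; have us : uniq s by case/andP: s_in.
rewrite /simple_reflection /coroot_pairing.
have e1 : row_root n 1 = simple_root n 1 by rewrite /row_root big_seq1.
have [k0|k_gt0] := posnP k.
  (* The pairing is -1 if 1 is a part and 1 otherwise, so the reflection adds or subtracts alpha_1 =
     e_1. *)
  rewrite parts_weight0E // count_uniq_mem // k0.
  case: (boolP (1%N \in s)) => s1.
    exists (rem 1%N s); first exact: parts_in_rem.
    by rewrite parts_weight_rem // e1 -[RHS]/(_ - (-1) *: _) scaleN1r opprK.
  exists (1%N :: s); first by apply: parts_in_cons => //=; have := ltn_ord k; lia.
  by rewrite parts_weight_cons e1 mul0rn subr0 scale1r.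
rewrite parts_weightE // !count_uniq_mem //.
have eS := row_rootS n k; have kn := ltn_ord k.
(* The pairing is 1 if only k is a part, -1 if only k+1 is, and 0 otherwise. By [eS], subtracting
   alpha_(k+1) turns -e_k into -e_(k+1). *)
case: (boolP ((k : nat) \in s)) => sk; case: (boolP (k.+1 \in s)) => sk1.
- by exists s => //; rewrite subrr scale0r subr0.
- exists (k.+1 :: rem (k : nat) s).
    apply: parts_in_cons; rewrite ?parts_in_rem //.
    by apply: contra sk1; exact: mem_rem.
  by rewrite parts_weight_cons parts_weight_rem // eS subr0 scale1r opprD addrA addrK.
- exists ((k : nat) :: rem k.+1 s).
    apply: parts_in_cons; rewrite ?parts_in_rem ?k_gt0 ?(ltnW kn) //.
    by apply: contra sk; exact: mem_rem.
  rewrite parts_weight_cons parts_weight_rem // eS sub0r scaleN1r opprK.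
  by rewrite addrA addrAC addrK.
- by exists s => //; rewrite subrr scale0r subr0.
Qed.

(** Stated as an equivalence so that the induction passes through [weyl_inv]; for a reflection the
    converse follows from involutivity. *)
Lemma weyl_group_parts_in n w x : weyl_group w ->
  (parts_weight n @` parts_in n) x <-> (parts_weight n @` parts_in n) (w x).
Proof.
move=> Ww; elim: Ww x => {w} [//|k x|f g _ IHf _ IHg x|f g _ IHf _ gK x].
- split; first exact: simple_reflection_parts_in.
  by move/(simple_reflection_parts_in k); rewrite simple_reflectionK.
- by rewrite IHg IHf.
- by rewrite [X in _ <-> X]IHf gK.
Qed.

Lemma weyl_orbit_reflection n x y (k : 'I_n) :
  weyl_orbit x y -> weyl_orbit x (simple_reflection k y).
Proof.
move=> [w Ww ->]; exists (simple_reflection k \o w) => //.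
by apply: weyl_comp => //; exact: weyl_reflection.
Qed.

(** In an increasing [s] the head is inserted last, so on its way up from 1 it meets only values
    absent from the tail. *)
Lemma weyl_orbit_parts_weight n s : sorted ltn s -> parts_in n s ->
  weyl_orbit (fundamental_weight n 1) (parts_weight n s).
Proof.
elim: s => [_ _|p s IHs ps_sorted].
  by exists id; [exact: weyl_id | rewrite /parts_weight big_nil subr0].
rewrite /parts_in /= => /andP[/andP[_ us] /andP[/andP[p_gt0 pn] sn]].
have {IHs} Ws : weyl_orbit (fundamental_weight n 1) (parts_weight n s).
  by apply: IHs; [exact: path_sorted ps_sorted | rewrite /parts_in us].
have {ps_sorted} /allP ps := order_path_min ltn_trans ps_sorted.
elim: p p_gt0 pn ps => // -[_ _ n_gt0 ps|p IHp _ pn ps].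
  have s1 : 1%N \notin s by apply/negP => /ps /=; rewrite ltnn.
  have -> : parts_weight n (1%N :: s) =
      simple_reflection (Ordinal n_gt0) (parts_weight n s).
    rewrite parts_weight_cons /simple_reflection /coroot_pairing.
    by rewrite parts_weight0E // (count_memPn s1) mul0rn subr0 scale1r /row_root big_seq1.
  exact: weyl_orbit_reflection.
have sp : p.+1 \notin s by apply/negP => /ps /=; lia.
have sp1 : p.+2 \notin s by apply/negP => /ps /=; lia.
(* [Ordinal pn] has value p+1, hence stands for node p+2; the pairing is 1 because p+1 is a part and
   p+2 is not. *)
have -> : parts_weight n (p.+2 :: s) =
    simple_reflection (Ordinal pn) (parts_weight n (p.+1 :: s)).
  rewrite /simple_reflection /coroot_pairing parts_weightE //=.
  rewrite (count_memPn sp) (count_memPn sp1) eqxx (ltn_eqF (ltnSn _)) subr0 scale1r.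
  by rewrite !parts_weight_cons (row_rootS n p.+1) opprD addrA.
apply: weyl_orbit_reflection; apply: IHp => //; first exact: ltnW.
by move=> q /ps /= /ltnW.
Qed.

(** Coordinate 0 tells whether 1 is a part; for p > 0, coordinate p settles p+1 once p is
    settled. *)
Lemma parts_weight_inj n s t : parts_in n s -> parts_in n t ->
  parts_weight n s = parts_weight n t -> s =i t.
Proof.
move=> /andP[us /allP sn] /andP[ut /allP tn] est p.
have [p_in|p_out] := boolP (0 < p <= n)%N; last first.
  by rewrite (negbTE (contra (sn p) p_out)) (negbTE (contra (tn p) p_out)).
suff : count_mem p s = count_mem p t.
  by rewrite !count_uniq_mem //; do 2!case: (p \in _).
case/andP: p_in; elim: p => // p IHp _ pn.
have := congr1 (fun x : weight n => x ord0 (Ordinal pn)) est.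
have [p0|p_gt0] := posnP p.
  rewrite !parts_weight0E // p0 => /addrI/oppr_inj/eqP.
  by rewrite eqr_pMn2r // eqr_nat => /eqP.
rewrite !parts_weightE //= (IHp p_gt0 (ltnW pn)) => /addrI/oppr_inj/eqP.
by rewrite eqr_nat => /eqP.
Qed.

Theorem lemma3p2 (n : nat) (hn : (0 < n)%N) :
  set_bij (strict_partitions n) (weyl_orbit (fundamental_weight n 1)) (@wt n).
Proof.
(* With the orbit identified as the image, only injectivity remains. *)
have orbitE : weyl_orbit (fundamental_weight n 1) = wt n @` strict_partitions n.
  rewrite image_wtE; apply/seteqP; split=> [_ [w Ww ->]|_ [s /andP[us sn] <-]].
    apply: (weyl_group_parts_in _ Ww).1; exists [::] => //.
    by rewrite /parts_weight big_nil subr0.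
  have ss : perm_eq (sort leq s) s by rewrite perm_sort.
  rewrite -(perm_parts_weight n ss); apply: weyl_orbit_parts_weight.
    by rewrite ltn_sorted_uniq_leq sort_uniq us sort_sorted //; exact: leq_total.
  by rewrite /parts_in (perm_uniq ss) us (perm_all _ ss).
rewrite orbitE; split=> //.
move=> la mu; rewrite !inE.
move=> /strict_partitions_parts_in[la_s la_in].
move=> /strict_partitions_parts_in[mu_s mu_in].
rewrite !wt_parts_weight => /(parts_weight_inj la_in mu_in).
apply: irr_sorted_eq la_s mu_s => [a b c /= ab ca|p]; last by rewrite /= ltnn.
exact: ltn_trans ca ab.
Qed.
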